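(* Let $k\ge 2$ and $n$ be positive integers. Then, for each $s\in\mathbb{Z}_n$, \[ \max_{d\mid n}\left(\left\lfloor\frac{d-1-\gcd(d,k)}{k}\right\rfloor+1\right)\frac{n}{d}\ \le\ m(k,n;s)\ \le\ \max_{d\mid n}\left(\left\lfloor\frac{d-2}{k}\right\rfloor+1\right)\frac{n}{d}, \] where the maxima are over all positive divisors $d$ of $n$.
   Context: $\mathbb{Z}_n=\mathbb{Z}/n\mathbb{Z}$. For $B\subset\mathbb{Z}_n$, the $k$-fold sumset is $kB=\{b_1+\cdots+b_k: b_i\in B \text{ for } 1\le i\le k\}$ (repetitions allowed). For $s\in\mathbb{Z}_n$, $m(k,n;s)=\max\{|B|: B\subset\mathbb{Z}_n,\ s\notin kB\}$ (the empty set is allowed, with empty sumset). $\lfloor\cdot\rfloor$ is the floor function (so $\lfloor -1/k\rfloor=-1$). *)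

(* Defs.v *)
From mathcomp Require Export all_boot all_order all_algebra.

Set Implicit Arguments.
Unset Strict Implicit.
Unset Printing Implicit Defensive.

Import Order.TTheory GRing.Theory Num.Theory.
Local Open Scope ring_scope.

Definition sumset (G : finZmodType) (k : nat) (B : {set G}) : {set G} :=
  [set \sum_(i < k) b i | b : {ffun 'I_k -> G} & [forall i, b i \in B]].

(* For k > 0 the empty set is admissible, so the default value 0 of \max plays
   no role. *)
Definition max_avoiding (G : finZmodType) (k : nat) (s : G) : nat :=
  \max_(B : {set G} | s \notin sumset k B) #|B|.

(* The base value F 1 is itself one of the terms when n > 0, so this is the
   maximum over the positive divisors of n even for F with negative values. *)
Definition max_divisors (n : nat) (F : nat -> int) : int :=
  \big[Num.max/F 1%N]_(d <- divisors n) F d.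

Definition lower_term (k n d : nat) : int :=
  (Num.floor ((d%:R - 1 - (gcdn d k)%:R) / k%:R : rat) + 1) * (n %/ d)%N%:Z.

Definition upper_term (k n d : nat) : int :=
  (Num.floor ((d%:R - 2) / k%:R : rat) + 1) * (n %/ d)%N%:Z.

(* Main.v *)
(** Upper bound: let S be the stabiliser of kB. Kneser's theorem gives
    |kB| >= k|B + S| - (k - 1)|S|; since kB misses the coset s + S, writing
    |B + S| = b|S| and d for the index of S yields kb < d + k - 1.

    Kneser's theorem is proved along the lines of DeVos, by induction on
    |A + B|, then on -(|A| + |B|), then on |A|. Translating B, one may assume
    that A and B meet in a proper nonempty subset of A, and induction applies to
    the pair (A n B, A u B), whose sumset lies in A + B. A pair (C, H) with C an
    H-periodic subset of A + B and |A n B| + |(A u B) + H| <= |C| + |H| is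
    called convergent. Unless A + B is H-periodic, some coset a + b + H is only
    partly contained in A + B; adjoining to C the sums falling in that coset
    gives a convergent pair with a smaller period.

    Lower bound: for d | n, take all the elements of an interval of residues
    modulo d, suitably translated. *)

Require Import Defs.
From mathcomp Require Import all_boot all_order all_algebra.
From mathcomp Require Import all_fingroup zify lra.

Set Implicit Arguments.
Unset Strict Implicit.
Unset Printing Implicit Defensive.

Import Order.TTheory GRing.Theory Num.Theory.

(* The same cardinal may be inferred through either of the two coercion paths
   from [finGroupType] to [finType], which [lia] does not identify. *)
Ltac card_lia :=
  repeat match goal with
  | H : is_true (leq _ _) |- _ => revert H
  | H : @eq nat _ _ |- _ => revert H
  end;
  try match goal with gT : finGroupType |- _ =>
    change ((gT : finStarMonoidType) : finType) with (gT : finType)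
  end; simpl;
  repeat match goal with |- context [card ?A] => generalize (card A) end;
  clear; lia.

(** * Cardinalities of periodic sets and cosets *)

Section Kneser.
Local Open Scope group_scope.
Variable gT : finGroupType.
Implicit Types (A B C D E F : {set gT}) (H K L M : {group gT}).

Lemma subset_mulG A H : A \subset A * H.
Proof. by rewrite -{1}(mulg1 A) mulgS // sub1G. Qed.

Lemma leq_card_mulG A H : #|A| <= #|A * H|.
Proof. exact/subset_leq_card/subset_mulG. Qed.

Lemma lcoset_sub_mulG A H x : x \in A -> x *: H \subset A * H.
Proof. by move=> Ax; rewrite mulSg // sub1set. Qed.

Lemma mulG_lcosetI A H K x : K \subset H ->
  (A * K) :&: x *: H = (A :&: x *: H) * K.
Proof.
move=> sKH; apply/setP=> y; rewrite inE; apply/andP/mulsgP.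
  case=> /mulsgP[z k Az Kk ->]; rewrite mem_lcoset mulgA.
  rewrite (groupMr _ (subsetP sKH _ Kk)) => Hz.
  by exists z k => //; rewrite inE Az mem_lcoset.
case=> z k /setIP[Az]; rewrite mem_lcoset => Hz Kk ->; split; first exact: mem_mulg.
by rewrite mem_lcoset mulgA groupM // (subsetP sKH).
Qed.

(** Counts the points of [Q] outside [P] through those lying in [U] or [V]. With [U] and [V] cosets
    of [H], this measures the loss from [D * H] to [D * K]. *)
Lemma leq_cardI2 (T : finType) (P Q U V : {set T}) :
    P \subset Q -> U \subset Q -> V \subset Q -> [disjoint U & V] ->
  #|P| + #|U| + #|V| <= #|Q| + #|P :&: U| + #|P :&: V|.
Proof.
move=> sPQ sUQ sVQ dUV.
have cUV : #|U :|: V| = #|U| + #|V| by rewrite cardsU (disjoint_setI0 dUV) cards0 subn0.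
have cPUV : #|P :&: (U :|: V)| <= #|P :&: U| + #|P :&: V|.
  by rewrite setIUr cardsU leq_subr.
have sUVQ : U :|: V \subset Q by rewrite subUset sUQ.
have := cardsID (U :|: V) P; have := cardsID (U :|: V) Q.
have := subset_leq_card (setSD (U :|: V) sPQ).
rewrite (setIidPr sUVQ); card_lia.
Qed.

Lemma leq_cardI1 (T : finType) (P Q U : {set T}) :
  P \subset Q -> U \subset Q -> #|P| + #|U| <= #|Q| + #|P :&: U|.
Proof.
move=> sPQ sUQ; have d0 : [disjoint U & (set0 : {set T})] by rewrite -setI_eq0 setI0.
by have := leq_cardI2 sPQ sUQ (sub0set Q) d0; rewrite setI0 cards0 !addn0.
Qed.

Lemma stab_sub_coset E H K z :
  E != set0 -> E \subset z *: H -> E * K = E -> K \subset H.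
Proof.
case/set0Pn=> x Ex sEH EK; apply/subsetP=> k Kk.
have xH : z^-1 * x \in H by rewrite -mem_lcoset (subsetP sEH).
rewrite -(groupMl _ xH) -mulgA -mem_lcoset (subsetP sEH) // -EK.
exact: mem_mulg.
Qed.

Lemma stab_disjoint_coset E K p : E * K = E -> p \notin E -> [disjoint E & p *: K].
Proof.
move=> EK pE; rewrite -setI_eq0; apply: contraNT pE => /set0Pn[y /setIP[Ey]].
by rewrite mem_lcoset -groupV invMg invgK => /(mem_mulg Ey); rewrite EK mulKVg.
Qed.

(* Each of [E], [F] misses a full coset of its own period, and two such cosets
   share at most [#|K :&: L|] points. *)
Lemma leq_card_periodicI E F H K L z :
    E \proper z *: H -> F \proper z *: H -> E * K = E -> F * L = F ->
    K \subset H -> L \subset H ->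
  #|E :&: F| + #|K| + #|L| <= #|H| + #|K :&: L|.
Proof.
case/properP=> sEH [p zp Ep] /properP[sFH [q zq Fq]] EK FL sKH sLH.
have cosetS (M : {group gT}) r : M \subset H -> r \in z *: H -> r *: M \subset z *: H.
  by move=> sMH /lcoset_eqP <-; rewrite mulgS.
have cI : #|p *: K :&: q *: L| <= #|K :&: L|.
  have [->|/set0Pn[r /setIP[]]] := eqVneq (p *: K :&: q *: L) set0.
    by rewrite cards0.
  move=> /lcoset_eqP <- /lcoset_eqP <-.
  rewrite -(card_lcoset (K :&: L) r); apply/subset_leq_card/subsetP=> y.
  by rewrite inE !mem_lcoset inE.
have := cardsUI (p *: K) (q *: L); rewrite !card_lcoset => cUI.
have dU : [disjoint E :&: F & p *: K :|: q *: L].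
  rewrite -setI_eq0 setIUr setU_eq0 !setI_eq0; apply/andP; split.
    exact: disjointWl (subsetIl _ _) (stab_disjoint_coset EK Ep).
  exact: disjointWl (subsetIr _ _) (stab_disjoint_coset FL Fq).
have : (E :&: F) :|: (p *: K :|: q *: L) \subset z *: H.
  by rewrite !subUset !cosetS // (subset_trans (subsetIl _ _)).
move/subset_leq_card; rewrite cardsU (disjoint_setI0 dU) cards0 card_lcoset; card_lia.
Qed.

Lemma mul0sg A : set0 * A = set0.
Proof. by apply/setP=> x; rewrite inE; apply/mulsgP=> -[u v]; rewrite inE. Qed.

Lemma mulsgK x : cancel (fun A => A :* x) (fun A => A :* x^-1).
Proof. by move=> A; rewrite -mulgA mulg_set1 mulgV mulg1. Qed.

(** * Convergent pairs in an abelian group *)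

Hypothesis cG : abelian [set: gT].

Lemma abelian_mulsgC A B : A * B = B * A.
Proof.
have sub (X Y : {set gT}) : X * Y \subset Y * X.
  apply/subsetP=> _ /mulsgP[x y Xx Yy ->].
  by rewrite (centsP cG x _ y) ?inE // mem_mulg.
by apply/eqP; rewrite eqEsubset !sub.
Qed.

Lemma sub_mul_setIU A B : (A :&: B) * (A :|: B) \subset A * B.
Proof.
by rewrite mulgU subUset (abelian_mulsgC _ A) mulgS ?mulSg ?subsetIl ?subsetIr.
Qed.

Definition weak_kneser A B := exists H,
  A * B * H = A * B /\ #|A| + #|B| <= #|A * B| + #|H|.

Definition strong_kneser A B := exists H,
  A * B * H = A * B /\ #|A * H| + #|B * H| <= #|A * B| + #|H|.

Definition convergent A B C H :=
  [/\ C \subset A * B, C * H = C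
    & #|A :&: B| + #|(A :|: B) * H| <= #|C| + #|H|].

Lemma convergent_descent A B C H a b :
    A :&: B != set0 ->
    (forall A' B', A' != set0 -> B' != set0 -> #|A' * B'| < #|A * B| ->
      strong_kneser A' B') ->
    convergent A B C H -> a \in A -> b \in B -> ~~ ((a * b) *: H \subset A * B) ->
  exists C' H', convergent A B C' H' /\ #|H'| < #|H|.
Proof.
move=> nAB IH [sC CH convC] Aa Bb nab; set D := A :|: B in convC *.
have dC : [disjoint C & (a * b) *: H].
  apply: (stab_disjoint_coset CH); apply: contra nab => Cab.
  by apply: subset_trans sC; rewrite -CH lcoset_sub_mulG.
(* [C] is nonempty, because [A :&: B] is and [#|H| <= #|D * H|]. *)
have ltC E : E \subset A * B -> [disjoint C & E] -> #|E| < #|A * B|.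
  move=> sE dCE.
  have : C :|: E \subset A * B by rewrite subUset sC.
  move/subset_leq_card; rewrite cardsU (disjoint_setI0 dCE) cards0 subn0.
  have := leq_card_mulG D H.
  have : #|H| <= #|D * H|.
    by rewrite -(card_lcoset H a) subset_leq_card // lcoset_sub_mulG // inE Aa.
  move: nAB; rewrite -card_gt0; card_lia.
have proper_ab E : E \subset A * B -> E \subset (a * b) *: H ->
    E \proper (a * b) *: H.
  move=> sE sEH; rewrite properE sEH /=.
  by apply: contra nab => /subset_trans; apply.
have sub_ab X Y x y : x * y = a * b ->
    (X :&: x *: H) * (Y :&: y *: H) \subset (a * b) *: H.
  move=> <-; apply/subsetP=> _ /mulsgP[u v /setIP[_ xu] /setIP[_ yv] ->].
  move: xu yv; rewrite !mem_lcoset => xu yv.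
  have -> : (x * y)^-1 * (u * v) = (x^-1 * u) * (y^-1 * v).
    rewrite invMg (centsP cG y^-1 _ x^-1) ?inE // -!mulgA; congr (_ * _).
    by rewrite !mulgA (centsP cG y^-1 _ u) ?inE.
  exact: groupM.
set A1 := A :&: a *: H; set B1 := B :&: b *: H.
set A2 := A :&: b *: H; set B2 := B :&: a *: H.
have A1a : a \in A1 by rewrite inE Aa lcoset_refl.
have B1b : b \in B1 by rewrite inE Bb lcoset_refl.
have sE : A1 * B1 \subset A * B by rewrite mulgSS ?subsetIl.
have sEH : A1 * B1 \subset (a * b) *: H by exact: sub_ab.
have nE : A1 * B1 != set0 by apply/set0Pn; exists (a * b); apply: mem_mulg.
have dE : [disjoint C & A1 * B1] by exact: disjointWr dC.
have [|||K [EK cK]] := IH A1 B1.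
- by apply/set0Pn; exists a.
- by apply/set0Pn; exists b.
- exact: ltC.
have sKH := stab_sub_coset nE sEH EK.
have pE := proper_ab _ sE sEH.
have ltKH : #|K| < #|H|.
  rewrite proper_card // properEneq sKH andbT; apply: contraTneq pE => eqKH.
  rewrite properE sEH /= negbK -EK eqKH.
  exact/lcoset_sub_mulG/mem_mulg.
have sDa : a *: H \subset D * H by rewrite lcoset_sub_mulG // inE Aa.
have sDb : b *: H \subset D * H by rewrite lcoset_sub_mulG // inE Bb orbT.
have DU M x : M \subset H ->
    (D * M) :&: x *: H = (A :&: x *: H) * M :|: (B :&: x *: H) * M.
  by move=> sMH; rewrite mulG_lcosetI // setIUl mulUg.
(* One coset [x *: H] of which [D * K] keeps this few points already pays for the smaller period
   [K]. *)
have case1 x : x *: H \subset D * H ->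
    #|(D * K) :&: x *: H| <= #|A1 * K| + #|B1 * K| ->
    exists C' H', convergent A B C' H' /\ #|H'| < #|H|.
  move=> sx cx; exists (C :|: A1 * B1), K; split=> //; split.
  - by rewrite subUset sC.
  - rewrite mulUg EK; congr (_ :|: _); apply/eqP; rewrite eqEsubset subset_mulG.
    by rewrite -{2}CH mulgS.
  rewrite cardsU (disjoint_setI0 dE) cards0 subn0.
  have := leq_cardI1 (mulgS D sKH) sx.
  rewrite (card_lcoset H x) -/D; card_lia.
(* [A1 * B1] alone suffices unless the two cosets differ, [A] meets [b *: H] and [B] meets
   [a *: H]. *)
have [eab|nab'] := eqVneq (a *: H) (b *: H).
  apply: (case1 a sDa); rewrite DU // -/A1 eab -/B1.
  by rewrite cardsU leq_subr.
have [A20|nA2] := eqVneq A2 set0.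
  apply: (case1 b sDb); rewrite DU // -/A2 A20 -/B1.
  by rewrite mul0sg set0U leq_addl.
have [B20|nB2] := eqVneq B2 set0.
  apply: (case1 a sDa); rewrite DU // -/B2 B20 -/A1.
  by rewrite mul0sg setU0 leq_addr.
have sF : A2 * B2 \subset A * B by rewrite mulgSS ?subsetIl.
have sFH : A2 * B2 \subset (a * b) *: H.
  by apply: sub_ab; rewrite (centsP cG) ?inE.
have dF : [disjoint C & A2 * B2] by exact: disjointWr dC.
have [|||L [FL cL]] := IH A2 B2 => //; first exact: ltC.
have nF : A2 * B2 != set0.
  have [[x Ax] [y By]] := (set0Pn _ nA2, set0Pn _ nB2).
  by apply/set0Pn; exists (x * y); rewrite mem_mulg.
have sLH := stab_sub_coset nF sFH FL.
have pF := proper_ab _ sF sFH.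
have cEF := leq_card_periodicI pE pF EK FL sKH sLH.
have sMK : K :&: L \subset K := subsetIl _ _.
have sML : K :&: L \subset L := subsetIr _ _.
have sMH := subset_trans sMK sKH.
have stabS X (N M : {group gT}) : X * M = X -> N \subset M -> X * N = X.
  move=> XM sNM; apply/eqP; rewrite eqEsubset subset_mulG andbT.
  by rewrite -{2}XM mulgS.
(* Both products are adjoined, with their common period. The losses in [a *: H] and [b *: H] add up,
   and [cEF] bounds the overlap of the products. *)
exists (C :|: (A1 * B1 :|: A2 * B2)), (K :&: L)%G; split; last first.
  exact: leq_ltn_trans (subset_leq_card sMK) ltKH.
split; first by rewrite !subUset sC sE.
  by rewrite !mulUg (stabS _ _ _ CH) ?(stabS _ _ _ EK) ?(stabS _ _ _ FL).
have dCEF : [disjoint C & A1 * B1 :|: A2 * B2].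
  by rewrite (disjointWr _ dC) // subUset sEH.
rewrite (cardsU C) (disjoint_setI0 dCEF) cards0 subn0.
have dab : [disjoint a *: H & b *: H].
  rewrite -setI_eq0; apply: contraNT nab' => /set0Pn[y /setIP[]].
  by move=> /lcoset_eqP <- /lcoset_eqP <-.
have := leq_cardI2 (mulgS D sMH) sDa sDb dab.
rewrite !card_lcoset !DU //= -/A1 -/A2 -/B1 -/B2.
have := (leq_card_setU (A1 * (K :&: L)) (B2 * (K :&: L))).1.
have := (leq_card_setU (A2 * (K :&: L)) (B1 * (K :&: L))).1.
have := subset_leq_card (mulgS A1 sMK).
have := subset_leq_card (mulgS B1 sMK).
have := subset_leq_card (mulgS A2 sML).
have := subset_leq_card (mulgS B2 sML).
have := cardsUI (A1 * B1) (A2 * B2).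
rewrite -/D; card_lia.
Qed.

(** The period shrinks until [A * B] is [H]-periodic; then [C \subset A * B] and
    [#|A :&: B| + #|A :|: B| = #|A| + #|B|] conclude. *)
Lemma weak_kneser_meet A B :
    A :&: B != set0 -> strong_kneser (A :&: B) (A :|: B) ->
    (forall A' B', A' != set0 -> B' != set0 -> #|A' * B'| < #|A * B| ->
      strong_kneser A' B') ->
  weak_kneser A B.
Proof.
move=> nAB [H0 [C0H0 cH0]] IH.
have conv0 : convergent A B ((A :&: B) * (A :|: B)) H0.
  split=> //; last by have := leq_card_mulG (A :&: B) H0; card_lia.
  exact: sub_mul_setIU.
move: {C0H0 cH0}H0 (_ * _) conv0 => H.
have [h] := ubnP #|H|; elim: h => // h IHh in H *; rewrite ltnS => leHh C convC.
have [sAB|] := boolP (A * B * H \subset A * B).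
  have [sC CH cC] := convC; exists H; split.
    by apply/eqP; rewrite eqEsubset sAB subset_mulG.
  have := cardsUI A B; have := subset_leq_card sC.
  have := leq_card_mulG (A :|: B) H; card_lia.
case/subsetPn=> _ /mulsgP[_ t /mulsgP[a b Aa Bb ->] Ht ->] nABt.
have [|C' [H' [convC' ltH']]] := convergent_descent nAB IH convC Aa Bb.
  by apply: contra nABt => /subsetP; apply; rewrite mem_lcoset mulKg.
exact: IHh (leq_trans ltH' leHh) _ convC'.
Qed.

(** * Stabilisers and the induction for Kneser's theorem *)

Definition set_stab A : {group gT} := 'C[A | 'Rs]%G.

Lemma set_stabP A x : reflect (A :* x = A) (x \in set_stab A).
Proof. by rewrite -rcosetE; apply: astab1P. Qed.

Lemma mul_set_stab A : A * set_stab A = A.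
Proof.
apply/eqP; rewrite eqEsubset subset_mulG andbT; apply/subsetP=> _ /mulsgP[x y Ax + ->].
by move/set_stabP=> <-; rewrite mem_mulg ?set11.
Qed.

Lemma sub_set_stab A H : A * H = A -> H \subset set_stab A.
Proof.
move=> AH; apply/subsetP=> x Hx; apply/set_stabP.
by apply/eqP; rewrite eqEcard card_rcoset leqnn andbT -{2}AH mulgS ?sub1set.
Qed.

Lemma mulsgG2 A B H : (A * H) * (B * H) = A * B * H.
Proof. by rewrite mulgA -(mulgA A) (abelian_mulsgC H) !mulgA -mulgA mulGid. Qed.

(** Multiplying both sets by [S] keeps their product, and any period of it lies in [S], so [S] can
    replace that period. *)
Lemma weak_strong_kneser A B (S := set_stab (A * B)) :
  weak_kneser (A * S) (B * S) -> strong_kneser A B.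
Proof.
rewrite /weak_kneser mulsgG2 mul_set_stab => -[H [ABH cH]]; exists S.
split; first exact: mul_set_stab.
have := subset_leq_card (sub_set_stab ABH); rewrite -/S; card_lia.
Qed.

Definition kneser_lt A' B' A B :=
  #|A' * B'| < #|A * B| \/ #|A' * B'| = #|A * B| /\
    (#|A| + #|B| < #|A'| + #|B'| \/
     #|A'| + #|B'| = #|A| + #|B| /\ #|A'| < #|A|).

Lemma kneser_lt_ind (P : {set gT} -> {set gT} -> Prop) :
  (forall A B, (forall A' B', kneser_lt A' B' A B -> P A' B') -> P A B) ->
  forall A B, P A B.
Proof.
move=> IH A B; have [p] := ubnP #|A * B|.
elim: p => // p IHp in A B *; rewrite ltnS => leABp.
(* A growing sum of cardinals is well-founded because it is at most [2 * #|gT|]. *)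
have [q] := ubnP (2 * #|gT| - (#|A| + #|B|)).
elim: q => // q IHq in A B leABp *; rewrite ltnS => leq_q.
have [r] := ubnP #|A|; elim: r => // r IHr in A B leABp leq_q *; rewrite ltnS => leAr.
apply: IH => A' B' lt'.
have mA : #|A'| <= #|gT| := max_card _; have mB : #|B'| <= #|gT| := max_card _.
case: lt' => [lt'|[eqAB [lt'|[eqS lt']]]].
- by apply: IHp; apply: leq_trans lt' leABp.
- apply: IHq; first by rewrite eqAB.
  card_lia.
- apply: IHr; rewrite ?eqAB ?eqS //.
  exact: leq_trans lt' leAr.
Qed.

Lemma weak_kneser_translate A B x : weak_kneser A (B :* x) -> weak_kneser A B.
Proof.
case=> H []; rewrite mulgA card_rcoset => ABH; rewrite card_rcoset => cH.
exists H; split=> //; apply: (can_inj (mulsgK x)).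
by rewrite -mulgA (abelian_mulsgC H) mulgA ABH.
Qed.

(* If no translate of [B] meets [A] in a nonempty proper subset, then [A] lies
   in a single coset of the stabiliser of [B]. *)
Lemma weak_kneser_nonempty A B : A != set0 -> B != set0 -> weak_kneser A B.
Proof.
move: A B; apply: kneser_lt_ind => A B IH nA nB.
(* Multiplying by [S] keeps the pair smaller: the product is unchanged, and if a cardinal grows, so
   does the sum of cardinals. *)
have IHs A' B' : A' != set0 -> B' != set0 -> kneser_lt A' B' A B ->
    strong_kneser A' B'.
  move=> nA' nB' lt'; apply: weak_strong_kneser; set S := set_stab _.
  have ne X : X != set0 -> X * S != set0.
    by rewrite -!card_gt0 => /leq_trans; apply; apply: leq_card_mulG.
  apply: IH; rewrite ?ne //.
  move: lt'; rewrite /kneser_lt mulsgG2 mul_set_stab.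
  have := leq_card_mulG A' S; have := leq_card_mulG B' S; card_lia.
have [a Aa] := set0Pn _ nA.
have [sA|/subsetPn[a' Aa' nSa']] := boolP (A \subset a *: set_stab B).
  have cS : B * set_stab B = B := mul_set_stab B.
  have eqAB : A * B = a *: B.
    apply/eqP; rewrite eqEsubset andbC mulSg ?sub1set //=.
    by rewrite (subset_trans (mulSg _ sA)) // -mulgA (abelian_mulsgC (set_stab B)) cS.
  exists (set_stab B); rewrite eqAB -mulgA cS; split=> //.
  by have := subset_leq_card sA; rewrite !card_lcoset; card_lia.
have [b Bb nBb] : exists2 b, b \in B & b * (a^-1 * a') \notin B.
  apply/exists_inP; apply: contraR nSa'; rewrite negb_exists_in => /forall_inP sB.
  rewrite mem_lcoset; apply/set_stabP/eqP; rewrite eqEcard card_rcoset leqnn andbT.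
  apply/subsetP=> _ /mulsgP[b c Bb /set1P-> ->].
  by have := sB b Bb; rewrite negbK.
(* This translation sends [b] to [a] and [b * (a^-1 * a')] to [a'], so [B'] contains [a] but not
   [a']. *)
apply: (@weak_kneser_translate _ _ (b^-1 * a)); set B' := B :* _.
have cAB' : #|A * B'| = #|A * B| by rewrite mulgA card_rcoset.
have cB' : #|B'| = #|B| by rewrite card_rcoset.
have B'a : a \in B' by rewrite mem_rcoset invMg invgK mulKVg.
have nB'a' : a' \notin B'.
  apply: contra nBb; rewrite mem_rcoset invMg invgK mulgA.
  by rewrite (centsP cG _ _ b) ?inE // (centsP cG a') ?inE.
have nI : A :&: B' != set0 by apply/set0Pn; exists a; rewrite inE Aa.
apply: weak_kneser_meet => // [|X Y nX nY]; last first.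
  by rewrite cAB' => lt'; apply: IHs => //; left.
apply: IHs => //; first by apply/set0Pn; exists a; rewrite inE Aa.
have ltI : #|A :&: B'| < #|A|.
  apply/proper_card/properP; split; first exact: subsetIl.
  by exists a' => //; rewrite inE negb_and nB'a' orbT.
have := subset_leq_card (sub_mul_setIU A B'); have := cardsUI A B'.
rewrite /kneser_lt -cAB' -cB'; card_lia.
Qed.

(** Factors [D] are added one at a time. A period of an intermediate power of [D] is one of the last
    power, hence lies in [S], so each step loses at most [#|S|]. *)
Lemma kneser_expg B k (S := set_stab (B ^+ k.+1)) : B != set0 ->
  k.+1 * #|B * S| <= #|B ^+ k.+1| + k * #|S|.
Proof.
move=> nB; pose D := B * S.
have nD : D != set0.
  by rewrite -card_gt0 (leq_trans _ (leq_card_mulG B S)) ?card_gt0.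
have Dk j : D ^+ j.+1 = B ^+ j.+1 * S.
  by elim: j => // j IHj; rewrite expgS IHj mulsgG2 -expgS.
have nDk j : D ^+ j.+1 != set0.
  have [x Dx] := set0Pn _ nD; apply/set0Pn; exists (x ^+ j.+1).
  by elim: j => // j IHj; rewrite !(expgS _ j.+1) mem_mulg.
have stabD j i H : D ^+ j.+1 * H = D ^+ j.+1 -> D ^+ (i + j.+1) * H = D ^+ (i + j.+1).
  by move=> DH; rewrite expgnDr -mulgA DH.
have main j : j <= k -> j.+1 * #|D| <= #|D ^+ j.+1| + j * #|S|.
  elim: j => [|j IHj] lejk; first by rewrite expg1; card_lia.
  have [H [DH]] := weak_kneser_nonempty nD (nDk j).
  have sHS : H \subset S.
    apply: sub_set_stab; rewrite -(mul_set_stab (B ^+ k.+1)) -Dk.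
    have -> : k.+1 = (k - j.+1) + j.+2 by lia.
    by apply: stabD; rewrite expgS.
  have := subset_leq_card sHS; have := IHj (ltnW lejk).
  have -> : D * D ^+ j.+1 = D ^+ j.+2 by rewrite (expgS D j.+1).
  rewrite !mulSn; card_lia.
have := main k (leqnn k); rewrite Dk mul_set_stab; exact.
Qed.

End Kneser.

(** * Upper bound for sets avoiding [s] *)

Local Open Scope ring_scope.

(** Bridge from the additive group [G] to the multiplicative notation of the group library. *)
Lemma sumsetE (G : finZmodType) k (B : {set G}) : sumset k B = (B ^+ k)%g.
Proof.
have -> : (B ^+ k = \prod_(i < k) B)%g by rewrite big_const card_ord iter_mulg_1.
apply/setP=> x; apply/imsetP/prodsgP=> [[b]|[b bB ->]].
  by rewrite inE => /forallP bB ->; exists b.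
exists [ffun i => b i]; first by rewrite inE; apply/forallP=> i; rewrite ffunE bB.
by apply: eq_bigr => i _; rewrite ffunE.
Qed.

Lemma dvdn_card_mulG (gT : finGroupType) (A : {set gT}) (H : {group gT}) :
  (#|H| %| #|A * H|%g)%N.
Proof.
have /card_partition -> : partition ((fun x => x *: H)%g @: A) (A * H)%g.
  apply/and3P; split.
  - apply/eqP/setP=> y; apply/bigcupP/mulsgP=> [[_ /imsetP[x Ax ->]]|[x h Ax Hh ->]].
      by rewrite mem_lcoset => Hy; exists x (x^-1 * y)%g; rewrite ?mulKVg.
    exists (x *: H)%g; last by rewrite mem_lcoset mulKg.
    exact: (imset_f (fun x => x *: H)%g).
  - apply/trivIsetP=> _ _ /imsetP[x _ ->] /imsetP[y _ ->].
    apply: contraR => /pred0Pn[z /andP[/= xz yz]].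
    by rewrite -(lcoset_eqP xz) -(lcoset_eqP yz).
  - apply/imsetP=> -[x _ /esym/setP/(_ x)]; by rewrite lcoset_refl inE.
by apply: dvdn_sum => _ /imsetP[x _ ->]; rewrite card_lcoset.
Qed.

Lemma avoiding_upper (G : finZmodType) k (s : G) (B : {set G}) :
    s \notin sumset k.+1 B -> B != set0 ->
  exists d b, [/\ (d %| #|G|)%N, (k.+1 * b < d + k)%N
    & (#|B| <= b * (#|G| %/ d))%N].
Proof.
rewrite sumsetE => sB nB.
have cG : abelian [set: G] := FinRing.zmod_abelian _.
have := kneser_expg cG k nB; set S := set_stab _ => cB.
have /dvdnP[b cBS] := dvdn_card_mulG B S.
have cS : (#|S| * #|[set: G] : S|%g)%N = #|G|.
  by rewrite Lagrange ?subsetT ?cardsT.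
have S_gt0 : (0 < #|S|)%N := cardG_gt0 S.
exists #|[set: G] : S|%g, b; split.
- by rewrite -cS dvdn_mull.
(* The missed coset of [S] makes the inequality strict. *)
- have dS := stab_disjoint_coset (mul_set_stab _) sB.
  have cBk : (#|B ^+ k.+1|%g + #|S| <= #|G|)%N.
    have := subset_leq_card (subsetT (B ^+ k.+1 :|: s *: S)%g).
    by rewrite cardsU (disjoint_setI0 dS) cards0 subn0 (card_lcoset S s) cardsT.
  rewrite -(leq_pmul2l S_gt0) mulnDr cS mulnS addnC (mulnC #|S| k).
  apply: leq_trans (leq_add cBk (leqnn _)); rewrite addnAC leq_add2r.
  by rewrite mulnCA (mulnC #|S|) -cBS.
- rewrite -[X in (X %/ _)%N]cS mulnK ?indexg_gt0 // -cBS.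
  exact: leq_card_mulG.
Qed.

(** * Terms of the two maxima *)

Lemma max_divisors_ge n (F : nat -> int) d :
  (0 < n)%N -> (d %| n)%N -> F d <= max_divisors n F.
Proof. by move=> n_gt0 dn; apply: le_bigmax_seq; rewrite -?dvdn_divisors. Qed.

Lemma max_divisors_le n (F : nat -> int) c :
  (0 < n)%N -> (forall d, (d %| n)%N -> F d <= c) -> max_divisors n F <= c.
Proof.
move=> n_gt0 leFc; rewrite /max_divisors big_seq; apply: bigmax_le => [|d].
  exact/leFc/dvd1n.
by rewrite -dvdn_divisors // => /leFc.
Qed.

(** The hypothesis amounts to [b - 1 <= (d - 2) / k], and [b - 1] is an integer. *)
Lemma upper_term_ge k n d b : (0 < k)%N -> (k * b + 2 <= d + k)%N ->
  (b * (n %/ d))%N%:Z <= upper_term k n d.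
Proof.
move=> k_gt0 le_kb; rewrite PoszM ler_wpM2r // -lerBlDr floor_ge_int.
rewrite ler_pdivlMr ?ltr0n // intrB.
move: le_kb; rewrite -(ler_nat rat) !natrD natrM -pmulrn; lra.
Qed.

Lemma lower_term_le k n d : (0 < k)%N -> (gcdn d k < d)%N ->
  lower_term k n d <= (((d - 1 - gcdn d k) %/ k).+1 * (n %/ d))%N%:Z.
Proof.
move=> k_gt0 ltgd; set m := ((d - 1 - gcdn d k) %/ k)%N.
rewrite PoszM ler_wpM2r // lezD1.
have : (d%:R - 1 - (gcdn d k)%:R) / k%:R < m.+1%:~R :> rat.
  rewrite ltr_pdivrMr ?ltr0n // -pmulrn -natrM.
  have : (d < m.+1 * k + 1 + gcdn d k)%N.
    have := ltn_ceil (d - 1 - gcdn d k) k_gt0; rewrite -/m; lia.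
  rewrite -(ltr_nat rat) !natrD; lra.
by move/(le_lt_trans (floor_le _)); rewrite ltr_int.
Qed.

(** The numerator is at most -1, so the floor is negative. For positive [d] this is the case where
    [d] divides [k]. *)
Lemma lower_term_le0 k n d : (0 < k)%N -> (d <= gcdn d k)%N -> lower_term k n d <= 0.
Proof.
move=> k_gt0 ledg; apply: mulr_le0_ge0 => //.
rewrite lezD1 -(ltr_int rat); apply: le_lt_trans (floor_le _) _.
rewrite ltr_pdivrMr ?ltr0n // mul0r.
move: ledg; rewrite -(ler_nat rat); lra.
Qed.

(** * Intervals of residues, for the lower bound *)

Lemma sum_Zp_mod n d (I : finType) (F : I -> 'I_n.+1) : (d %| n.+1)%N ->
  nat_of_ord (\sum_i F i)%R = \sum_i (F i : nat) %[mod d].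
Proof.
move=> dn; apply: (big_rec2 (fun (x : 'I_n.+1) (y : nat) => x = y %[mod d])) => //.
move=> i x y _ IH; rewrite /= modn_dvdm //.
by rewrite -modnDmr IH modnDmr.
Qed.

(* [B] consists of the [m + 1] residues [c, ..., c + m] modulo [d]. As [k c] is
   congruent to [g (s %/ g + 1)], the residue of [s] is not one of
   [k c, ..., k c + k m]. *)
Lemma exists_avoiding k n d (s : 'I_n.+1) (g := gcdn d k) :
    (0 < k)%N -> (d %| n.+1)%N -> (g < d)%N ->
  exists2 B : {set 'I_n.+1}, s \notin sumset k B
    & #|B| = (((d - 1 - g) %/ k).+1 * (n.+1 %/ d))%N.
Proof.
have ltD x y : (x <= d - 1 - y -> y < d -> y + x < d)%N by clear; lia.
move=> k_gt0 dn ltgd; set m := ((d - 1 - g) %/ k)%N; set e := (n.+1 %/ d)%N.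
have d_gt0 : (0 < d)%N by apply: leq_ltn_trans ltgd.
have [u v kuv _] := egcdnP d k_gt0.
(* As [u * k] is congruent to [g], this makes [k * c] congruent to the least multiple of [g]
   exceeding [s]. *)
pose c := (u * (s %/ g).+1)%N.
have lekm : (m * k <= d - 1 - g)%N := leq_trunc_div _ _.
have kc : k * c = g * (s %/ g).+1 %[mod d].
  by rewrite mulnA (mulnC k) kuv mulnDl (gcdnC k) mulnAC modnMDl.
pose f (x : 'I_m.+1 * 'I_e) : 'I_n.+1 := inZp (x.2 * d + x.1 + c).
have ltmd : (m < d)%N by rewrite (leq_ltn_trans (leq_addl g m)) ?ltD ?leq_div.
have f_inj : injective f.
  move=> [r q] [r' q'] /(congr1 val) /= /eqP; rewrite eqn_modDr => /eqP.
  have ltd (a : 'I_m.+1) : (a < d)%N by rewrite (leq_trans (ltn_ord a)).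
  have lt_n (a : 'I_m.+1) (b : 'I_e) : (b * d + a < n.+1)%N.
    rewrite -(divnK dn) -/e; apply: (@leq_trans (b.+1 * d)).
      by rewrite mulSn addnC ltn_add2r.
    by rewrite leq_mul2r ltn_ord orbT.
  rewrite !modn_small // => eq_f.
  congr (_, _); apply: val_inj => /=.
    by have := congr1 (modn^~ d) eq_f; rewrite !modnMDl !modn_small.
  by have := congr1 (divn^~ d) eq_f; rewrite !divnMDl // !divn_small // !addn0.
exists [set f x | x : 'I_m.+1 * 'I_e]; last first.
  by rewrite card_imset // card_prod !card_ord.
apply/imsetP=> -[b]; rewrite inE => /forallP bB def_s.
have /fin_all_exists[r r_b] i : exists a : 'I_m.+1, b i = a + c %[mod d].
  have /imsetP[[a q] _ ->] := bB i.
  by exists a; rewrite /= modn_dvdm // -addnA modnMDl.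
have : s = \sum_(i < k) (r i + c) %[mod d].
  rewrite def_s sum_Zp_mod //.
  apply: (big_ind2 (fun x y : nat => x = y %[mod d])) => [//|x x' y y' ex ey|i _].
    by rewrite -modnDm ex ey modnDm.
  exact: r_b.
rewrite big_split /= sum_nat_const card_ord.
set t := (\sum_(i < k) r i)%N => s_t.
have letm : (t <= m * k)%N.
  rewrite mulnC -[X in (_ <= X * _)%N]card_ord -sum_nat_const; apply: leq_sum => i _.
  by rewrite -ltnS.
have g_gt0 : (0 < g)%N by rewrite gcdn_gt0 d_gt0.
have lt_sg := ltn_pmod s g_gt0.
(* After [s %/ g * g] is cancelled, both sides are below [d], so they are equal, against
   [s %% g < g]. *)
have : s %% g = g + t %[mod d].
  apply/eqP; rewrite -(eqn_modDl (s %/ g * g)) -divn_eq; apply/eqP.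
  by rewrite s_t -modnDmr kc modnDmr mulnS (mulnC g) addnA addnC (addnC g).
have lt_gt : (g + t < d)%N by rewrite ltD ?(leq_trans letm).
rewrite (modn_small lt_gt) (modn_small (ltn_trans lt_sg ltgd)) => eq_sg.
by rewrite eq_sg ltnNge leq_addr in lt_sg.
Qed.

(* The modulus is n.+1: 'I_n.+1 carries the additive group structure of
   Z/(n+1)Z for every n, including the trivial group, which 'Z_1 would not. *)
Theorem proposition3p1 (k n : nat) (hk : (2 <= k)%N) (s : 'I_n.+1) :
  max_divisors n.+1 (lower_term k n.+1) <= (max_avoiding k s)%:Z
    <= max_divisors n.+1 (upper_term k n.+1).
Proof.
have k_gt0 : (0 < k)%N := ltnW hk.
apply/andP; split.
  apply: max_divisors_le => // d dn.
  have [ltgd|ledg] := ltnP (gcdn d k) d; last first.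
    by apply: le_trans (lower_term_le0 _ k_gt0 ledg) _.
  have [B sB cB] := exists_avoiding s k_gt0 dn ltgd.
  apply: le_trans (lower_term_le _ k_gt0 ltgd) _; rewrite -cB lez_nat.
  exact: leq_bigmax_cond.
(* The divisor 1 with [b = 0] handles the empty set and the start of the induction on the
   maximum. *)
have max_ge0 : 0%N%:Z <= max_divisors n.+1 (upper_term k n.+1).
  apply: le_trans (max_divisors_ge (upper_term k n.+1) (ltn0Sn n) (dvd1n _)).
  by apply: (@upper_term_ge _ _ _ 0); rewrite ?muln0.
apply: (big_ind (fun m : nat => m%:Z <= _)) => [|x y lex ley|B sB].
- exact: max_ge0.
- by rewrite /maxn; case: ifP.
have [->|nB] := eqVneq B set0.
  by rewrite cards0.
case: k hk k_gt0 sB {max_ge0} => // k hk k_gt0 sB.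
have [d [b []]] := avoiding_upper sB nB; rewrite card_ord => dn lt_b cB.
apply: le_trans (max_divisors_ge _ _ dn) => //.
apply: le_trans (upper_term_ge _ k_gt0 _); first by rewrite lez_nat; exact: cB.
lia.
Qed.
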